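(* Let $(X,+)$ be a $3$-divisible abelian group and $C$ a $3$-divisible cyclic group. For a loop $Q$ the following are equivalent: (i) $Q$ is a Moufang loop containing $X$ as a normal subloop and $C$ as a subloop with $Q=CX$ and $C\cap X=1$; (ii) $Q$ is isomorphic to $C\ltimes_{(f^3,\beta)}X$ for some Moufang permutation $f$ on $(X,+)$ with associated biadditive mapping $\beta$ (such that this loop is defined, i.e., if $C$ is finite then $|f^3|$ and $r(f^3,\beta)$ divide $|C|$).
   Context: A loop is Moufang if it satisfies $xy\cdot zx=(x\cdot yz)x$ for all $x,y,z$. A group is $3$-divisible if every element is a cube. A permutation $f$ of $(X,+)$ is a Moufang permutation if $\beta(x,y)=f^{-1}(f(x)+f(y))-x-y$ is symmetric, alternating and biadditive, and for all $x,y,z$: $\beta(\beta(x,y),z)=0$ and $\beta(f(x),f(y))=f(\beta(f^3(x),y))$; $\beta$ is the associated biadditive mapping. $\mathrm{Rad}(\beta)=\{x:\beta(x,y)=0\ \forall y\}$; for a permutation $g$ and such $\gamma$, $r(g,\gamma)$ is the least positive $r$ with $\sum_{0\le k<r}g^k(x)\in\mathrm{Rad}(\gamma)$ for all $x$ ($\infty$ if none). $I(i,j)$ is $\emptyset$ if $i=j$, $\{i,\dots,j-1\}$ if $i<j$, $\{j,\dots,i-1\}$ if $j<i$. For $C=\langle b\rangle$ and $(g,\gamma)=(f^3,\beta)$, $C\ltimes_{(g,\gamma)}X$ is the loop on $C\times X$ with multiplication $(b^i,x)(b^j,y)=(b^{i+j},g^{-j}(x)+y+\sum_{k\in I(i+j,-j)}g^{-k}(\gamma(x,y)))$.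 *)

(* Defs.v *)
From mathcomp Require Import all_boot all_order all_algebra.
Set Implicit Arguments. Unset Strict Implicit. Unset Printing Implicit Defensive.
Import Order.TTheory GRing.Theory Num.Theory.
Local Open Scope ring_scope.

Definition three_divisible (G : zmodType) : Prop :=
  forall x : G, exists y : G, y *+ 3 = x.

Definition is_loop (Q : Type) (mul : Q -> Q -> Q) : Prop :=
  (exists e : Q, forall x, mul e x = x /\ mul x e = x) /\
  (forall a b : Q, exists! x : Q, mul a x = b) /\
  (forall a b : Q, exists! y : Q, mul y a = b).

Definition moufang (Q : Type) (mul : Q -> Q -> Q) : Prop :=
  forall x y z : Q, mul (mul x y) (mul z x) = mul (mul x (mul y z)) x.

Definition subloop (Q : Type) (mul : Q -> Q -> Q) (N : Q -> Prop) : Prop :=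
  (exists a, N a) /\
  (forall a b, N a -> N b -> N (mul a b)) /\
  (forall a b z, N a -> N b -> mul a z = b -> N z) /\
  (forall a b z, N a -> N b -> mul z a = b -> N z).

Definition normal_subloop (Q : Type) (mul : Q -> Q -> Q) (N : Q -> Prop) : Prop :=
  subloop mul N /\
  forall x y : Q,
    (forall z, (exists2 n, N n & z = mul x n) <-> (exists2 n, N n & z = mul n x)) /\
    (forall z, (exists2 n, N n & z = mul (mul n x) y) <->
               (exists2 n, N n & z = mul n (mul x y))) /\
    (forall z, (exists2 n, N n & z = mul y (mul x n)) <->
               (exists2 n, N n & z = mul (mul y x) n)).

Definition beta (X : zmodType) (f finv : X -> X) (x y : X) : X :=
  finv (f x + f y) - x - y.

Definition f3 (X : Type) (f : X -> X) : X -> X := fun x => f (f (f x)).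

Definition moufang_perm (X : zmodType) (f finv : X -> X) : Prop :=
  cancel f finv /\ cancel finv f /\
  (forall x y, beta f finv x y = beta f finv y x) /\
  (forall x, beta f finv x x = 0) /\
  (forall x y z, beta f finv (x + y) z = beta f finv x z + beta f finv y z) /\
  (forall x y z, beta f finv x (y + z) = beta f finv x y + beta f finv x z) /\
  (forall x y z, beta f finv (beta f finv x y) z = 0) /\
  (forall x y, beta f finv (f x) (f y) = f (beta f finv (f3 f x) y)).

Definition in_rad (X : zmodType) (gamma : X -> X -> X) (x : X) : Prop :=
  forall y, gamma x y = 0.

Definition least_pos (P : nat -> Prop) (n : nat) : Prop :=
  (0 < n)%N /\ P n /\ forall m, (0 < m)%N -> (m < n)%N -> ~ P m.

(** "the least positive r with P divides n" (false if no such r, i.e. r = oo) *)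
Definition least_divides (P : nat -> Prop) (n : nat) : Prop :=
  exists r, least_pos P r /\ (r %| n)%N.

Definition r_prop (X : zmodType) (g : X -> X) (gamma : X -> X -> X) (r : nat) : Prop :=
  forall x, in_rad gamma (\sum_(0 <= k < r) iter k g x).

Definition perm_order_prop (X : Type) (g : X -> X) (m : nat) : Prop :=
  forall x, iter m g x = x.

Definition zpow (X : Type) (g ginv : X -> X) (k : int) (x : X) : X :=
  match k with
  | Posz n => iter n g x
  | Negz n => iter n.+1 ginv x
  end.

Definition sumI (X : zmodType) (i j : int) (F : int -> X) : X :=
  \sum_(0 <= t < absz (i - j)) F (Num.min i j + t%:Z).

(** second component of (b^i,x)(b^j,y) in C |x_(g,gamma) X *)
Definition sd_comp (X : zmodType) (g ginv : X -> X) (gamma : X -> X -> X)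
    (i j : int) (x y : X) : X :=
  zpow g ginv (- j) x + y +
  sumI (i + j) (- j) (fun k => zpow g ginv (- k) (gamma x y)).

(** Q is isomorphic to C |x_(g,gamma) X, C = <b>.  The multiplication is
    given for every choice of exponents i, j representing the C-components
    (it is well defined exactly when it does not depend on that choice). *)
Definition iso_to_sd (Q : Type) (mul : Q -> Q -> Q) (C X : zmodType) (b : C)
    (g ginv : X -> X) (gamma : X -> X -> X) : Prop :=
  exists phi : Q -> C * X,
    bijective phi /\
    forall (q q' : Q) (i j : int),
      b *~ i = (phi q).1 -> b *~ j = (phi q').1 ->
      phi (mul q q') = (b *~ (i + j), sd_comp g ginv gamma i j (phi q).2 (phi q').2).

Definition sd_defined (C X : zmodType) (b : C) (g : X -> X) (gamma : X -> X -> X) : Prop :=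
  forall n, least_pos (fun m => b *+ m = 0) n ->
    least_divides (perm_order_prop g) n /\ least_divides (r_prop g gamma) n.

(* Main.v *)
(* For c in C put f_c x = c x c^-1 and define c x . y = c (x *_c y). The Moufang
   identities give f_k (x *_c y) = f_k x *_(c k^-3) f_k y and
   c x . d y = c d (f_d^-1 x *_(c d^2) y). As *_1 is the addition of X and every c
   is a cube k^3, each *_c is an abelian group operation that f_k transports to +.
   Two further instances of the identity (x u x)(x^-1 v) = x (u v), with x in X,
   make x *_c y - x - y biadditive, alternating and two-step nilpotent; this is
   the biadditive mapping of the Moufang permutation f_k, where k^3 = b.
   Conversely, every product of the semidirect product can be written
   (b^i, x)(b^j, y) = (b^(i+j), f^-m (f^(i-j) x + f^m y)) with m = i + 2 j, so
   that the Moufang identity only requires comparing the defects of additivity of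
   the powers of f, which are controlled by beta. *)
Require Import Defs.
From mathcomp Require Import all_boot all_order all_algebra.
From mathcomp Require Import zify.
From Stdlib Require Import Classical ClassicalEpsilon.
Set Implicit Arguments. Unset Strict Implicit. Unset Printing Implicit Defensive.
Import Order.TTheory GRing.Theory Num.Theory.
Local Open Scope ring_scope.

(** * Deciding identities of abelian groups by reflection *)

Inductive zexp := ZVar of nat | ZZero | ZAdd of zexp & zexp | ZOpp of zexp.

Fixpoint zeval (X : zmodType) (env : seq X) (e : zexp) : X :=
  match e with
  | ZVar i => nth 0 env i
  | ZZero => 0
  | ZAdd e1 e2 => zeval env e1 + zeval env e2
  | ZOpp e1 => - zeval env e1
  end.

(* Multiplicity of variable [i] in [e], as (positive, negative) occurrences. *)
Fixpoint zcoef (e : zexp) (i : nat) : nat * nat :=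
  match e with
  | ZVar j => (nat_of_bool (eqn i j), 0%N)
  | ZZero => (0%N, 0%N)
  | ZAdd e1 e2 => ((zcoef e1 i).1 + (zcoef e2 i).1, (zcoef e1 i).2 + (zcoef e2 i).2)%N
  | ZOpp e1 => ((zcoef e1 i).2, (zcoef e1 i).1)
  end.

Lemma zeval_coef (X : zmodType) (env : seq X) (e : zexp) :
  zeval env e = \sum_(i < size env)
    (nth 0 env i *+ (zcoef e i).1 - nth 0 env i *+ (zcoef e i).2).
Proof.
elim: e => [j||e1 IH1 e2 IH2|e1 IH1] /=.
- have [lt_j|le_j] := ltnP j (size env).
    rewrite (bigD1 (Ordinal lt_j)) //= big1 => [|i].
      by rewrite (_ : eqn j j = (j == j)) // eqxx mulr1n mulr0n subr0 addr0.
    rewrite -val_eqE /= => /negbTE ij.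
    by rewrite (_ : eqn i j = (val i == j)) // ij mulr0n subrr.
  rewrite nth_default // big1 // => i _.
  rewrite (_ : eqn i j = (val i == j)) // (_ : _ == _ = false) ?mulr0n ?subrr //.
  by apply/negbTE; rewrite neq_ltn (leq_trans (ltn_ord i) le_j).
- by rewrite big1 // => i _; rewrite mulr0n subrr.
- rewrite IH1 IH2 -big_split /=; apply: eq_bigr => i _.
  by rewrite !mulrnDr opprD addrACA.
- by rewrite IH1 -sumrN; apply: eq_bigr => i _; rewrite opprB.
Qed.

(** Adding positive to opposite negative multiplicities compares integer coefficients inside [nat],
    so the test is settled by computation. *)
Lemma zeval_eq (X : zmodType) (env : seq X) (e1 e2 : zexp) :
  all (fun i => eqn ((zcoef e1 i).1 + (zcoef e2 i).2) ((zcoef e2 i).1 + (zcoef e1 i).2))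
      (iota 0 (size env)) ->
  zeval env e1 = zeval env e2.
Proof.
move=> /allP H; rewrite !zeval_coef; apply: eq_bigr => i _.
have /H/eqnP/(congr1 (fun k => nth 0 env i *+ k)) : val i \in iota 0 (size env).
  by rewrite mem_iota /=.
rewrite !mulrnDr => E; apply/eqP; rewrite subr_eq addrAC; apply/eqP.
by rewrite -E addrK.
Qed.

Ltac zmod_find x l :=
  match l with
  | ?y :: _ => let _ := match goal with _ => unify x y end in constr:(0%N)
  | _ :: ?t => let n := zmod_find x t in constr:(S n)
  end.
Ltac zmod_atoms l t :=
  lazymatch t with
  | ?a + ?b => let l1 := zmod_atoms l a in zmod_atoms l1 b
  | - ?a => zmod_atoms l a
  | 0 => l
  | _ => match l with
         | _ => let n := zmod_find t l in l
         | _ => constr:(t :: l)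
         end
  end.
Ltac zmod_reify l t :=
  lazymatch t with
  | ?a + ?b => let ra := zmod_reify l a in let rb := zmod_reify l b in
               constr:(ZAdd ra rb)
  | - ?a => let ra := zmod_reify l a in constr:(ZOpp ra)
  | 0 => constr:(ZZero)
  | _ => let n := zmod_find t l in constr:(ZVar n)
  end.
(* Decides equalities that hold in every abelian group. *)
Ltac zmod :=
  lazymatch goal with
  | |- @eq ?X ?a ?b =>
    let l0 := zmod_atoms (@nil X) a in
    let l := zmod_atoms l0 b in
    let ra := zmod_reify l a in
    let rb := zmod_reify l b in
    apply: (@zeval_eq _ l ra rb); vm_compute; reflexivity
  end.

(** * Integer powers of a permutation *)

(** The descending step goes from [m + 1] to [m], so the rule [zpowS] serves both directions and
    injectivity finishes the descent. *)
Lemma int_step_ind (P : int -> Prop) :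
  P 0 -> (forall m, P m -> P (m + 1)) -> (forall m, P (m + 1) -> P m) ->
  forall m, P m.
Proof.
move=> P0 Pup Pdown; elim/int_ind => [//|n IH|n IH].
  by rewrite -addn1 PoszD; apply: Pup.
by apply: Pdown; rewrite -addn1 PoszD opprD addrNK.
Qed.

Section IntegerPowers.
Variables (X : Type) (f finv : X -> X).
Hypotheses (fK : cancel f finv) (finvK : cancel finv f).

Lemma zpowS m x : zpow f finv (m + 1) x = f (zpow f finv m x).
Proof.
case: m => [n|[|n]]; first by rewrite -PoszD addn1.
- by rewrite /= finvK.
- have -> : Negz n.+1 + 1 = Negz n by lia.
  by rewrite /= finvK.
Qed.

Lemma zpowD m n x : zpow f finv (m + n) x = zpow f finv m (zpow f finv n x).
Proof.
elim/int_step_ind: m => [|m IH|m]; first by rewrite add0r.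
  by rewrite addrAC !zpowS IH.
by rewrite addrAC !zpowS => /(can_inj fK).
Qed.

Lemma zpow1 x : zpow f finv 1 x = f x. Proof. by []. Qed.
Lemma zpow0 x : zpow f finv 0 x = x. Proof. by []. Qed.
Lemma zpowN1 x : zpow f finv (-1) x = finv x. Proof. by []. Qed.

Lemma zpowNK m : cancel (zpow f finv m) (zpow f finv (- m)).
Proof. by move=> x; rewrite -zpowD addNr. Qed.

Lemma zpowKN m : cancel (zpow f finv (- m)) (zpow f finv m).
Proof. by move=> x; rewrite -zpowD subrr. Qed.

Lemma zpow_f3 m x : zpow (f3 f) (f3 finv) m x = zpow f finv (m * 3) x.
Proof.
suff H n y : iter n (f3 f) y = zpow f finv (n%:Z * 3) y /\
             iter n (f3 finv) y = zpow f finv (- (n%:Z * 3)) y.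
  case: m => n; first exact: (H n x).1.
  have -> : Negz n * 3 = - (n.+1%:Z * 3) by lia.
  exact: (H n.+1 x).2.
elim: n => [|n [IH1 IH2]]; first by [].
rewrite !iterS IH1 IH2 /f3; split.
  have -> : n.+1%:Z * 3 = n%:Z * 3 + 1 + 1 + 1 by lia.
  by rewrite !zpowS.
have -> : - (n.+1%:Z * 3) = (-1) + ((-1) + ((-1) + - (n%:Z * 3))) by lia.
by rewrite !zpowD.
Qed.

End IntegerPowers.

(** * Moufang permutations *)

Section MoufangPermutation.
Variables (X : zmodType) (f finv : X -> X).
Hypothesis Hf : moufang_perm f finv.

Local Notation F := (zpow f finv).
Local Notation bt := (beta f finv).
Local Notation rad := (in_rad bt).

Let fK : cancel f finv. Proof. by case: Hf. Qed.
Let finvK : cancel finv f. Proof. by case: Hf => _ []. Qed.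
Let FD := zpowD fK finvK.
Let FNK := zpowNK fK finvK.

Lemma betaC x y : bt x y = bt y x. Proof. by case: Hf => _ [_ []]. Qed.
Lemma betaxx x : bt x x = 0. Proof. by case: Hf => _ [_ [_ []]]. Qed.
Lemma betaDl x y z : bt (x + y) z = bt x z + bt y z.
Proof. by case: Hf => _ [_ [_ [_ []]]]. Qed.
Lemma betaDr x y z : bt x (y + z) = bt x y + bt x z.
Proof. by case: Hf => _ [_ [_ [_ [_ []]]]]. Qed.
Lemma beta_rad x y : rad (bt x y).
Proof. by move=> z; case: Hf => _ [_ [_ [_ [_ [_ []]]]]]. Qed.
Lemma beta_f x y : bt (f x) (f y) = f (bt (f3 f x) y).
Proof. by case: Hf => _ [_ [_ [_ [_ [_ []]]]]]. Qed.

(** Polarise β(x + y, x + y) = 0. Signs in front of values of β can therefore be ignored from here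
    on. *)
Lemma beta2 x y : bt x y + bt x y = 0.
Proof.
by have := betaxx (x + y); rewrite betaDl !betaDr !betaxx add0r addr0 (betaC y).
Qed.

Lemma beta0l y : bt 0 y = 0.
Proof. by apply: (addIr (bt 0 y)); rewrite -betaDl !add0r. Qed.

Lemma f_add_beta x y : f (x + y + bt x y) = f x + f y.
Proof.
have -> : x + y + bt x y = finv (f x + f y) by rewrite /beta; zmod.
exact: finvK.
Qed.

Lemma moufang_perm0 : f 0 = 0.
Proof.
by have := f_add_beta 0 0; rewrite beta0l !addr0 => H; apply: (addIr (f 0)); rewrite add0r.
Qed.

Lemma rad0 : rad 0. Proof. by move=> y; rewrite beta0l. Qed.
Lemma radD x y : rad x -> rad y -> rad (x + y).
Proof. by move=> Hx Hy z; rewrite betaDl Hx Hy addr0. Qed.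

Lemma f_add_rad x r : rad r -> f (x + r) = f x + f r.
Proof. by move=> Hr; rewrite -f_add_beta betaC Hr addr0. Qed.

(** Both sides become β(f x, f y) under f, and that is symmetric. *)
Lemma beta_f3 x y : bt (f3 f x) y = bt x (f3 f y).
Proof. by apply: (can_inj fK); rewrite -beta_f betaC beta_f betaC. Qed.

Lemma rad_f r : rad r -> rad (f r).
Proof. by move=> Hr y; rewrite -(finvK y) beta_f beta_f3 Hr moufang_perm0. Qed.

Lemma rad_finv r : rad r -> rad (finv r).
Proof.
move=> Hr y; have -> : y = f3 f (f3 finv y) by rewrite /f3 !finvK.
by apply: (can_inj fK); rewrite -beta_f3 -beta_f finvK Hr moufang_perm0.
Qed.

Lemma rad_zpow m r : rad r -> rad (F m r).
Proof.
move=> Hr; elim/int_step_ind: m => [//|m IH|m IH].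
  by rewrite (zpowS finvK); apply: rad_f.
by rewrite -(fK (F m r)) -(zpowS finvK); apply: rad_finv.
Qed.

Lemma zpow_add_rad m x r : rad r -> F m (x + r) = F m x + F m r.
Proof.
move=> Hr; elim/int_step_ind: m => [//|m IH|m].
  by rewrite !(zpowS finvK) IH f_add_rad //; apply: rad_zpow.
rewrite !(zpowS finvK) -f_add_rad; first by move/(can_inj fK).
exact: rad_zpow.
Qed.

Lemma zpow_perm0 m : F m 0 = 0.
Proof.
by have := zpow_add_rad m 0 rad0; rewrite addr0 => H; apply: (addIr (F m 0)); rewrite add0r.
Qed.

(** Moving one f^3 across β and then using the defining identity three times gives β(f^6 w, v) =
    β(f^3 w, f^3 v) = f^3 β(f^9 w, v); then put w = f^-6 u. *)
Lemma beta_f3_zpow x y : bt (f3 f x) y = F (-3) (bt x y).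
Proof.
suff H u v : bt u v = F 3 (bt (f3 f u) v).
  by rewrite [in RHS]H FNK.
have E w : bt (f3 f (f3 f w)) v = F 3 (bt (f3 f (f3 f (f3 f w))) v).
  by rewrite beta_f3 {2 3}/f3 !beta_f.
by have := E (f3 finv (f3 finv u)); rewrite {1 2 3 4 6 7 8 9}/f3 !finvK.
Qed.

Lemma beta_zpowl t x y : bt (F (3 * t) x) y = F (- (3 * t)) (bt x y).
Proof.
elim/int_step_ind: t => [//|t IH|t].
  have -> : 3 * (t + 1) = 3 * t + 1 + 1 + 1 by lia.
  by rewrite !(zpowS finvK) -/(f3 f _) beta_f3_zpow IH -FD; congr (zpow _ _ _ _); lia.
have -> : 3 * (t + 1) = 3 * t + 1 + 1 + 1 by lia.
rewrite !(zpowS finvK) -/(f3 f _) beta_f3_zpow.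
have -> : - (3 * t + 1 + 1 + 1) = -3 + - (3 * t) by lia.
by rewrite FD => /(can_inj (FNK _)).
Qed.

Lemma beta_zpow2 a x y : bt (F a x) (F a y) = F (- (2 * a)) (bt x y).
Proof.
have H u v : bt (f u) (f v) = F (-2) (bt u v) by rewrite beta_f beta_f3_zpow -(zpowS finvK).
elim/int_step_ind: a => [//|a IH|a].
  rewrite !(zpowS finvK) H IH -FD; congr (zpow _ _ _ _); lia.
rewrite !(zpowS finvK) H.
have -> : - (2 * (a + 1)) = -2 + - (2 * a) by lia.
by rewrite FD => /(can_inj (FNK _)).
Qed.

(** The two exponents must agree modulo 3: the common part is moved out by [beta_zpow2], the
    multiples of 3 by [beta_zpowl]. *)
Lemma beta_zpow a t t' x y :
  bt (F (a + 3 * t) x) (F (a + 3 * t') y) = F (- (2 * a) - 3 * t - 3 * t') (bt x y).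
Proof.
rewrite !FD beta_zpow2 beta_zpowl betaC beta_zpowl betaC -!FD; congr (zpow _ _ _ _); lia.
Qed.

(** * Defects of additivity of the powers of f, and the Moufang identity *)

Definition defect m u v := F m (u + v) - F m u - F m v.

(* The defect of [F m] factors through [beta] by an additive, [f]-equivariant
   operator on the radical; all the properties of [defect] follow from those of [beta]. *)
Lemma defect_factor m : exists phi : X -> X,
  [/\ forall r, rad r -> rad (phi r),
      forall r s, rad r -> rad s -> phi (r + s) = phi r + phi s,
      forall k r, rad r -> phi (F k r) = F k (phi r)
    & forall u v, defect m u v = phi (bt u v)].
Proof.
have f2 k x y : F k (bt x y) + F k (bt x y) = 0.
  by rewrite -zpow_add_rad ?beta2 ?zpow_perm0 //; apply: beta_rad.
(* The sign change against [f_add_beta] is harmless because values of β have exponent 2. *)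
have fD u v : f (u + v) = f u + f v + f (bt u v).
  have := f_add_beta u v; rewrite f_add_rad; last exact: beta_rad.
  by move=> <-; rewrite -addrA (f2 1) addr0.
elim/int_step_ind: m => [|m [phi [H1 H2 H3 H4]]|m [phi [H1 H2 H3 H4]]].
- exists (fun _ => 0); split=> //.
  + by move=> *; apply: rad0.
  + by move=> *; rewrite addr0.
  + by move=> *; rewrite zpow_perm0.
  + by move=> u v; rewrite /defect /zpow /=; zmod.
(* The new term is f applied to β(F m u, F m v) = F (-2m) β(u, v). *)
- exists (fun r => f (phi r) + F (1 - 2 * m) r); split.
  + by move=> r Hr; apply: radD; [apply/rad_f/H1|apply: rad_zpow].
  + by move=> r s Hr Hs; rewrite H2 // f_add_rad ?zpow_add_rad //; [zmod|apply: H1].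
  + move=> k r Hr; rewrite H3 // zpow_add_rad; last exact: rad_zpow.
    by rewrite -!FD (addrC k) -(zpowS finvK) addrC FD addrC.
  + move=> u v; rewrite /defect !(zpowS finvK).
    have -> : F m (u + v) = F m u + F m v + phi (bt u v) by rewrite -H4 /defect; zmod.
    rewrite f_add_rad; last by apply/H1/beta_rad.
    rewrite fD beta_zpow2 -(zpow1 f finv (F (- _) _)) -FD; zmod.
(* The relation of the ascending step, solved for the operator at [m]. *)
- exists (fun r => finv (phi r + F (1 - 2 * m) r)); split.
  + by move=> r Hr; apply: rad_finv; apply: radD; [apply: H1|apply: rad_zpow].
  + move=> r s Hr Hs; rewrite H2 // zpow_add_rad //.
    rewrite -!(zpowN1 f finv) -[RHS]zpow_add_rad; last by apply: radD; [apply: H1|apply: rad_zpow].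
    by congr (F (-1)); zmod.
  + move=> k r Hr; rewrite H3 //.
    have -> : F (1 - 2 * m) (F k r) = F k (F (1 - 2 * m) r) by rewrite -!FD addrC.
    rewrite -zpow_add_rad; last exact: rad_zpow.
    by rewrite -!(zpowN1 f finv) -!FD addrC.
  + move=> u v.
    have := H4 u v; rewrite /defect !(zpowS finvK) => E.
    apply: (can_inj fK); rewrite finvK -E.
    (* The defect of [F m] is not yet known to be radical. The candidate [d] is radical by [E], and
       it is identified with the defect after applying f. *)
    have [d Hd Ed] : exists2 d, rad d & F m (u + v) = F m u + F m v + d.
      exists (finv (f (F m (u + v)) - f (F m u) - f (F m v) + F (1 - 2 * m) (bt u v))).
        by rewrite E; apply: rad_finv; apply: radD; [apply/H1/beta_rad|apply/rad_zpow/beta_rad].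
      apply: (can_inj fK); rewrite f_add_rad; last first.
        by rewrite E; apply: rad_finv; apply: radD; [apply/H1/beta_rad|apply/rad_zpow/beta_rad].
      rewrite finvK fD beta_zpow2 -(zpow1 f finv (F (- _) _)) -FD -[LHS]addr0.
      by rewrite -(f2 (1 - 2 * m) u v); zmod.
    rewrite Ed; have -> : F m u + F m v + d - F m u - F m v = d by zmod.
    rewrite f_add_rad // fD beta_zpow2 -(zpow1 f finv (F (- _) _)) -FD -[LHS]addr0.
    by rewrite -(f2 (1 - 2 * m) u v); zmod.
Qed.

Lemma zpow_add m u v : F m (u + v) = F m u + F m v + defect m u v.
Proof. by rewrite /defect; zmod. Qed.

Lemma defect_rad m u v : rad (defect m u v).
Proof. by have [phi [H _ _ ->]] := defect_factor m; apply/H/beta_rad. Qed.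

Lemma defectC m u v : defect m u v = defect m v u.
Proof. by have [phi [_ _ _ H]] := defect_factor m; rewrite !H betaC. Qed.

Lemma defectDr m u v w : defect m u (v + w) = defect m u v + defect m u w.
Proof.
have [phi [_ H _ E]] := defect_factor m; rewrite !E betaDr H //; exact: beta_rad.
Qed.

Lemma defectDl m u v w : defect m (u + v) w = defect m u w + defect m v w.
Proof. by rewrite defectC defectDr !(defectC _ w). Qed.

Lemma defect_radr m u r : rad r -> defect m u r = 0.
Proof. by move=> Hr; rewrite /defect zpow_add_rad //; zmod. Qed.

Lemma defect2 m u v : defect m u v + defect m u v = 0.
Proof.
have [phi [_ H _ E]] := defect_factor m.
(* [phi 0] is evaluated by writing 0 as [bt 0 0], which turns it back into [defect m 0 0]. *)
rewrite E -H; [|exact: beta_rad..]; rewrite beta2 -[in LHS](beta0l 0) -E.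
exact/defect_radr/rad0.
Qed.

Lemma defectxx m u : defect m u u = 0.
Proof.
have [phi [_ H _ E]] := defect_factor m.
rewrite E betaxx -[in LHS](beta0l 0) -E; exact/defect_radr/rad0.
Qed.

Lemma defect_zpow m a t t' u v :
  defect m (F (a + 3 * t) u) (F (a + 3 * t') v) =
  F (- (2 * a) - 3 * t - 3 * t') (defect m u v).
Proof.
have [phi [_ _ H E]] := defect_factor m.
by rewrite !E beta_zpow H //; apply: beta_rad.
Qed.

(** Chain rule for F (m + n) = F m ∘ F n: the inner defect is radical, so [F m] splits it off
    additively. *)
Lemma defect_addm m n u v :
  defect (m + n) u v = defect m (F n u) (F n v) + F m (defect n u v).
Proof.
rewrite {1}/defect !FD zpow_add zpow_add_rad; last exact: defect_rad.
by rewrite zpow_add; zmod.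
Qed.

(** The chain rule for -m + m = 0, with the sign absorbed by exponent 2. *)
Lemma defectN m u v : defect (- m) (F m u) (F m v) = F (- m) (defect m u v).
Proof.
have := defect_addm (- m) m u v; rewrite addNr.
have -> : defect 0 u v = 0 by rewrite /defect !zpow0; zmod.
move=> E; apply: (addIr (F (- m) (defect m u v))).
by rewrite -E -zpow_add_rad ?defect2 ?zpow_perm0 //; apply: defect_rad.
Qed.

(** These are the second components of xy·zx and (x·yz)x with the common outer power F (-(3i + j +
    2k)) removed. The main terms agree one by one; the defects are then compared separately for the
    pairs (x,y), (x,z), (y,z) and (x,x). *)
Lemma moufang_identity_zpow i j k x y z (s := i + j + k) :
  F (- s) (F (i - j) x + F (i + 2 * j) y) + F s (F (k - i) z + F (k + 2 * i) x) =
  F k (F (- s) (F (i - j - k) x + F (i + j) (F (j - k) y + F (j + 2 * k) z))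
       + F (3 * i + j + k) x).
Proof.
have shift m a t t' c c' n u v : c = a + 3 * t -> c' = a + 3 * t' ->
    n = - (2 * a) - 3 * t - 3 * t' ->
    defect m (F c u) (F c' v) = F n (defect m u v).
  by move=> -> -> ->; apply: defect_zpow.
have radF n m u v : rad (F n (defect m u v)) by apply/rad_zpow/defect_rad.
have tors n m u v : F n (defect m u v) + F n (defect m u v) = 0.
  by rewrite -zpow_add_rad ?defect2 ?zpow_perm0 //; apply: defect_rad.
rewrite (zpow_add (i + j)) -!FD.
set A := F (i - j - k) x; set Y := F (i + j + (j - k)) y.
set Z := F (i + j + (j + 2 * k)) z; set w := F (3 * i + j + k) x.
set n1 := defect (i + j) _ _.
set u := F (i - j) x; set v := F (i + 2 * j) y.
set w' := F (k - i) z; set x' := F (k + 2 * i) x.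
have -> : F (- s) (A + (Y + Z + n1)) =
    F (- s) A + F (- s) Y + F (- s) Z +
    (defect (- s) A Y + defect (- s) A Z + defect (- s) Y Z + F (- s) n1).
  rewrite addrA zpow_add_rad; last exact: defect_rad.
  by rewrite zpow_add (zpow_add _ Y) defectDr; zmod.
(* Pairing the main terms and putting the radical part last lets [zpow_add] and bilinearity produce
   all the mixed defects under [F k]. *)
have -> : forall p q r t, p + q + r + t + w = p + q + (r + w) + t by move=> *; zmod.
rewrite (zpow_add_rad k (_ + _ + (_ + w))); last first.
  by apply/radD/radF; apply/radD/defect_rad; apply/radD; apply: defect_rad.
rewrite (zpow_add_rad k _ (radF _ _ _ _)) !(zpow_add_rad k _ (defect_rad _ _ _)).
rewrite (zpow_add k) (zpow_add k (F (- s) A)) (zpow_add k (F (- s) Z)).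
rewrite (zpow_add (- s)) (zpow_add s) defectDl !defectDr.
have Su : F k (F (- s) A) = F (- s) u by rewrite -!FD; congr (zpow _ _ _ _); lia.
have Sv : F k (F (- s) Y) = F (- s) v by rewrite -!FD; congr (zpow _ _ _ _); lia.
have Sw : F k (F (- s) Z) = F s w' by rewrite -!FD; congr (zpow _ _ _ _); lia.
have Sx : F k w = F s x' by rewrite -!FD; congr (zpow _ _ _ _); lia.
(* Expand the defect of F (k - s) at A, Y by the chain rule in both orders. The leftover F (-s)
   (defect k A Y) equals the last term and cancels it. *)
have XY : defect (- s) u v = F k (defect (- s) A Y) +
    defect k (F (- s) A) (F (- s) Y) + defect k (F (- s) Y) w.
  rewrite [F k _ + _]addrC -defect_addm addrC [k + _]addrC defect_addm.
  have -> : F k A = u by rewrite -!FD; congr (zpow _ _ _ _); lia.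
  have -> : F k Y = v by rewrite -!FD; congr (zpow _ _ _ _); lia.
  have -> : F (- s) (defect k A Y) = F (k - 2 * j - 3 * i) (defect k x y).
    rewrite (@shift _ (i - j - k) 0 j _ _ (2 * k - 2 * i - j)); try lia.
    by rewrite -FD; congr (zpow _ _ _ _); lia.
  rewrite (defectC k _ w) -FD (@shift k (j - 2 * k) (i + k) 0 _ _ (k - 2 * j - 3 * i)); try lia.
  by rewrite addrC -addrA tors addr0.
(* Expand along s = k + (i + j). The outer term is the last one on the right; the inner one is
   matched with the defect of F (k - s) = F (-(i + j)) through [defectN]. *)
have XZ : defect s w' x' = F k (defect (- s) A Z) +
    defect k (F (- s) A) (F (- s) Z) + defect k (F (- s) Z) w.
  have -> : s = k + (i + j) by rewrite /s; lia.
  rewrite defect_addm addrC.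
  have -> : F (i + j) w' = F (- s) Z by rewrite -!FD; congr (zpow _ _ _ _); lia.
  have -> : F (i + j) x' = w by rewrite -!FD; congr (zpow _ _ _ _); lia.
  have -> : k + (i + j) = s by rewrite /s; lia.
  congr (_ + _); rewrite [RHS]addrC -defect_addm.
  have -> : k - s = - (i + j) by lia.
  have -> : A = F (i + j) (F (- (2 * j) - k) x).
    by rewrite -!FD; congr (zpow _ _ _ _); lia.
  rewrite /Z (FD (i + j) (j + 2 * k)) defectN.
  rewrite (@shift _ (- (2 * j) - k) 0 (j + k) _ _ (j - k)); try lia.
  rewrite defectC (@shift _ (k + 2 * i) 0 (- i) _ _ (- (2 * k) - i)); try lia.
  by rewrite -!FD; congr (zpow _ _ _ _); lia.
(* The chain rule combines the outer two terms into the defect of F (-(i + j)), which by [defectN]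
   equals the middle term. *)
have YZ : F k (defect (- s) Y Z) + F k (F (- s) n1) +
    defect k (F (- s) Y) (F (- s) Z) = 0.
  rewrite addrAC (addrC (F k _)) -defect_addm.
  have -> : k - s = - (i + j) by lia.
  rewrite /Y /Z (FD (i + j)) (FD (i + j)) defectN -FD.
  by have -> : k - s = - (i + j) by lia.
(* Both arguments are powers applied to x with exponents differing by 3s, so the alternating law
   applies after shifting. *)
have XX : defect k (F (- s) A) w = 0.
  rewrite -FD (@shift _ (- (2 * j) - 2 * k) 0 s _ _ (4 * j + 4 * k - 3 * s));
    rewrite ?defectxx ?zpow_perm0 //; rewrite /s; lia.
rewrite Su Sv Sw Sx XY XZ -[LHS]addr0 -YZ -[LHS]addr0 -XX; zmod.
Qed.

End MoufangPermutation.

(** * Closed form of the semidirect multiplication *)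

Lemma sumI_id (X : zmodType) (F : int -> X) i : sumI i i F = 0.
Proof. by rewrite /sumI subrr big_geq. Qed.

(** When i < j, raising i removes the term [F i] from the range; exponent 2 makes this the same as
    adding it. *)
Lemma sumI_succ (X : zmodType) (F : int -> X) i j : (forall k, F k + F k = 0) ->
  sumI (i + 1) j F = sumI i j F + F i.
Proof.
move=> F2; rewrite /sumI; have [le_ji|lt_ij] := lerP j i.
  have -> : absz (i + 1 - j)%R = (absz (i - j)%R).+1 by lia.
  have -> : Num.min (i + 1) j = j by lia.
  rewrite big_nat_recr //=; congr (_ + F _); lia.
have -> : absz (i - j)%R = (absz (i + 1 - j)%R).+1 by lia.
have -> : Num.min (i + 1) j = i + 1 by lia.
set n := absz _; rewrite big_nat_recl //= (addr0 i) addrAC F2 add0r.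
by apply: eq_bigr => t _; congr F; lia.
Qed.

Section SemidirectComponent.
Variables (X : zmodType) (f finv : X -> X).
Hypothesis Hf : moufang_perm f finv.

Local Notation F := (zpow f finv).
Local Notation bt := (beta f finv).

Let fK : cancel f finv. Proof. by case: Hf. Qed.
Let finvK : cancel finv f. Proof. by case: Hf => _ []. Qed.
Let FD := zpowD fK finvK.

(** Each unit step in [m] contributes one value of β by [f_add_beta]; these values fill the interval
    I(m + j, j), whatever the sign of [m]. *)
Lemma zpow_conj_add m j x y :
  F (- m) (F m (F (3 * j) x) + F m y) =
  F (3 * j) x + y + sumI (m + j) j (fun k => F (- (3 * k)) (bt x y)).
Proof.
have G2 k : F (- (3 * k)) (bt x y) + F (- (3 * k)) (bt x y) = 0.
  by rewrite -(zpow_add_rad Hf) ?beta2 ?(zpow_perm0 Hf) //; apply: beta_rad.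
have step n : F (- (n + 1)) (F (n + 1) (F (3 * j) x) + F (n + 1) y) =
    F (- n) (F n (F (3 * j) x) + F n y) + F (- (3 * (n + j))) (bt x y).
  rewrite !(zpowS finvK) -(f_add_beta Hf) -(zpow1 f finv (_ + _ + _)) -FD.
  have -> : - (n + 1) + 1 = - n by lia.
  rewrite (beta_zpow2 Hf) (beta_zpowl Hf) (zpow_add_rad Hf); last first.
    by do 2 apply: (rad_zpow Hf); apply: beta_rad.
  by rewrite -!FD; congr (_ + zpow _ _ _ _); lia.
elim/int_step_ind: m => [|m IH|m]; first by rewrite add0r sumI_id addr0.
  by rewrite step IH (addrAC m 1) sumI_succ // addrA.
by rewrite step (addrAC m 1) sumI_succ // addrA => /addIr.
Qed.

(** [zpow_conj_add] with m = i + 2j and -j in place of j, which makes the range I(i + j, -j). *)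
Lemma sd_compE i j x y :
  sd_comp (f3 f) (f3 finv) bt i j x y =
  F (- (i + 2 * j)) (F (i - j) x + F (i + 2 * j) y).
Proof.
have := zpow_conj_add (i + 2 * j) (- j) x y.
rewrite -FD; have -> : i + 2 * j + 3 * - j = i - j by lia.
have -> : i + 2 * j + - j = i + j by lia.
move=> ->; rewrite /sd_comp !(zpow_f3 fK finvK); congr (_ + _ + _).
  by congr (zpow _ _ _ _); lia.
apply: eq_bigr => t _; rewrite (zpow_f3 fK finvK); congr (zpow _ _ _ _); lia.
Qed.

End SemidirectComponent.

(** * The semidirect product is a Moufang loop *)

(** [p] maps to an abelian group, and by divisibility each coset involved is a full fibre of [p], so
    coset equalities become equalities in [C]. *)
Lemma kernel_normal_subloop (Q : Type) (mul : Q -> Q -> Q) (C : zmodType)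
    (p : Q -> C) (N : Q -> Prop) :
  is_loop mul -> (forall x y, p (mul x y) = p x + p y) -> (forall q, N q <-> p q = 0) ->
  normal_subloop mul N.
Proof.
move=> [[e eP] [ldiv rdiv]] pM NP.
have p1 : p e = 0.
  by apply: (addIr (p e)); rewrite -pM (proj1 (eP e)) add0r.
split; first split; first by exists e; apply/NP.
  split; first by move=> a b /NP Ha /NP Hb; apply/NP; rewrite pM Ha Hb addr0.
  split=> a b z /NP Ha /NP Hb E; apply/NP; move: (pM a z) (pM z a).
    by rewrite E Ha Hb add0r.
  by rewrite E Ha Hb addr0.
have lcoset x z : (exists2 n, N n & z = mul x n) <-> p z = p x.
  split=> [[n /NP Hn ->]|E]; first by rewrite pM Hn addr0.
  have [n [En _]] := ldiv x z; exists n => //; apply/NP.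
  by apply: (addrI (p x)); rewrite -pM En addr0.
have rcoset x z : (exists2 n, N n & z = mul n x) <-> p z = p x.
  split=> [[n /NP Hn ->]|E]; first by rewrite pM Hn add0r.
  have [n [En _]] := rdiv x z; exists n => //; apply/NP.
  by apply: (addIr (p x)); rewrite -pM En add0r.
move=> x y; split; [|split] => z; first by rewrite lcoset rcoset.
  rewrite rcoset pM; split=> [[n /NP Hn ->]|E]; first by rewrite !pM Hn add0r.
  have [w [Ew _]] := rdiv y z; have [n [En _]] := rdiv x w.
  exists n; last by rewrite En Ew.
  by apply/NP; apply: (addIr (p x + p y)); rewrite addrA -!pM En Ew E add0r.
rewrite lcoset pM; split=> [[n /NP Hn ->]|E]; first by rewrite !pM Hn addr0.
have [w [Ew _]] := ldiv y z; have [n [En _]] := ldiv x w.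
exists n; last by rewrite En Ew.
by apply/NP; apply: (addrI (p y + p x)); rewrite -addrA -!pM En Ew E addr0.
Qed.

Lemma semidirect_is_moufang (X C : zmodType) (b : C)
    (hb : forall c : C, exists i : int, c = b *~ i)
    (Q : Type) (mul : Q -> Q -> Q) (hQ : is_loop mul) (f finv : X -> X) :
  moufang_perm f finv ->
  iso_to_sd mul b (f3 f) (f3 finv) (beta f finv) ->
  moufang mul /\
  exists (iota : X -> Q) (kappa : C -> Q),
     injective iota /\ (forall x y, iota (x + y) = mul (iota x) (iota y)) /\
     normal_subloop mul (fun q => exists x, q = iota x) /\
     injective kappa /\ (forall c d, kappa (c + d) = mul (kappa c) (kappa d)) /\
     subloop mul (fun q => exists c, q = kappa c) /\
     (forall q, exists c x, q = mul (kappa c) (iota x)) /\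
     (forall c x, kappa c = iota x -> c = 0 /\ x = 0).
Proof.
move=> Hf [phi [[psi phiK psiK] phiM]].
have fK : cancel f finv by case: Hf.
have finvK : cancel finv f by case: Hf => _ [].
pose F := zpow f finv.
have F0 m : F m 0 = 0 by apply: (zpow_perm0 Hf).
have FD m n x : F (m + n) x = F m (F n x) by apply: zpowD.
have FNK m : cancel (F m) (F (- m)) by apply: zpowNK.
have FKN m : cancel (F (- m)) (F m) by apply: zpowKN.
have phi_inj : injective phi := can_inj phiK.
have PM q q' i j : (phi q).1 = b *~ i -> (phi q').1 = b *~ j ->
    phi (mul q q') =
    (b *~ (i + j), F (- (i + 2 * j)) (F (i - j) (phi q).2 + F (i + 2 * j) (phi q').2)).
  by move=> Hq Hq'; rewrite (phiM _ _ i j) // (sd_compE Hf).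
have exb q : exists i, (phi q).1 = b *~ i by apply: hb.
have p1M q q' : (phi (mul q q')).1 = (phi q).1 + (phi q').1.
  have [i Hi] := exb q; have [j Hj] := exb q'.
  by rewrite (PM _ _ i j) //= Hi Hj mulrzDr.
pose iota x := psi (0, x); pose kappa c := psi (c, 0).
have iotaE x : phi (iota x) = (0, x) by apply: psiK.
have kappaE c : phi (kappa c) = (c, 0) by apply: psiK.
have NP q : (exists x, q = iota x) <-> (phi q).1 = 0.
  split=> [[x ->]|E]; first by rewrite iotaE.
  by exists (phi q).2; apply: phi_inj; rewrite iotaE -E -surjective_pairing.
have KP q : (exists c, q = kappa c) <-> (phi q).2 = 0.
  split=> [[x ->]|E]; first by rewrite kappaE.
  by exists (phi q).1; apply: phi_inj; rewrite kappaE -E -surjective_pairing.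
(* Fix exponents of b for the three elements. Collecting powers of f reduces the identity to
   [moufang_identity_zpow], whose factor [F k] merges with the outer power. *)
split.
  move=> x y z; apply: phi_inj.
  have [i Hi] := exb x; have [j Hj] := exb y; have [k Hk] := exb z.
  have Exy := PM _ _ _ _ Hi Hj; have Ezx := PM _ _ _ _ Hk Hi.
  have Eyz := PM _ _ _ _ Hj Hk.
  have Hxy : (phi (mul x y)).1 = b *~ (i + j) by rewrite Exy.
  have Hzx : (phi (mul z x)).1 = b *~ (k + i) by rewrite Ezx.
  have Hyz : (phi (mul y z)).1 = b *~ (j + k) by rewrite Eyz.
  have Ex_yz := PM _ _ _ _ Hi Hyz.
  have Hx_yz : (phi (mul x (mul y z))).1 = b *~ (i + (j + k)) by rewrite Ex_yz.
  rewrite (PM _ _ _ _ Hxy Hzx) (PM _ _ _ _ Hx_yz Hi) Ex_yz Exy Ezx Eyz /=.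
  congr (_, _); first by congr (_ *~ _); lia.
  have := moufang_identity_zpow Hf i j k (phi x).2 (phi y).2 (phi z).2.
  rewrite -/F /=; set x0 := (phi x).2; set y0 := (phi y).2; set z0 := (phi z).2 => E.
  rewrite -!FD.
  have -> : i + j - (k + i) + - (i + 2 * j) = - (i + j + k) by lia.
  have -> : i + j + 2 * (k + i) + - (k + 2 * i) = i + j + k by lia.
  rewrite E; have -> : i - (j + k) = i - j - k by lia.
  have -> : i + 2 * (j + k) + - (j + 2 * k) = i + j by lia.
  have -> : i + (j + k) - i + - (i + 2 * (j + k)) = - (i + j + k) by lia.
  have -> : i + (j + k) + 2 * i = 3 * i + j + k by lia.
  by rewrite -FD; congr (F _ _); lia.
exists iota, kappa; split; first by move=> x y /(congr1 phi); rewrite !iotaE => -[].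
split.
  move=> x y; apply: phi_inj.
  by rewrite (PM _ _ 0 0) !iotaE ?mulr0z //= /F /zpow.
split; first exact: (@kernel_normal_subloop _ _ _ (fun q => (phi q).1)).
split; first by move=> c d /(congr1 phi); rewrite !kappaE => -[].
have kappaM c d : kappa (c + d) = mul (kappa c) (kappa d).
  have [i ->] := hb c; have [j ->] := hb d; apply: phi_inj.
  by rewrite (PM _ _ i j) !kappaE //= !F0 addr0 F0 mulrzDr.
split=> //; split.
  split; first by exists (kappa 0), 0.
  split; first by move=> _ _ [c ->] [d ->]; exists (c + d).
  split=> _ _ z [c ->] [d ->] /(congr1 phi); have [i Hi] := hb c; have [j Hj] := exb z.
    rewrite (PM _ _ i j) ?kappaE //= F0 add0r FNK => -[_ E]; exact/KP.
  rewrite (PM _ _ j i) ?kappaE //= F0 addr0 => -[_ E]; apply/KP.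
  apply: (can_inj (FNK (j - i))); apply: (can_inj (FKN (j + 2 * i))).
  by rewrite E !F0.
split=> [q|c x /(congr1 phi)]; last by rewrite kappaE iotaE => -[-> ->].
exists (phi q).1, (phi q).2; apply: phi_inj; have [i Hi] := exb q.
rewrite (PM _ _ i 0) ?kappaE ?iotaE ?mulr0z //= F0 add0r FNK.
by rewrite addr0 -Hi -surjective_pairing.
Qed.

(** * From Moufang loops to Moufang permutations *)

Section TwistedAdditions.
(* In the application [ac c] is conjugation of [X] by [c], and [st c x y] is
   the element of [X] with [(c x) y = c (st c x y)]. *)
Variables (X C : zmodType) (ac : C -> X -> X) (st : C -> X -> X -> X).
Hypotheses (C3 : three_divisible C)
  (ac0 : forall x, ac 0 x = x) (acD : forall c d x, ac (c + d) x = ac c (ac d x))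
  (st0 : forall x y, st 0 x y = x + y)
  (stx0 : forall c x, st c x 0 = x) (st0x : forall c x, st c 0 x = x)
  (stxx : forall c x, st c x x = x + x)
  (ac_st : forall c k x y, ac k (st c x y) = st (c - k *+ 3) (ac k x) (ac k y))
  (st_shift : forall c w y z,
     st c (st c (st (c + c) w y) (ac c w)) (z - ac c w) = st (c + c) w (st c y z))
  (st_double : forall c w y, st c (st (c + c) w y) (ac c w) - ac c w = st c w y).

Lemma acK k : cancel (ac k) (ac (- k)).
Proof. by move=> x; rewrite -acD addNr ac0. Qed.
Lemma acNK k : cancel (ac (- k)) (ac k).
Proof. by move=> x; rewrite -acD subrr ac0. Qed.

Lemma ac_st3 k x y : ac k (st (k *+ 3) x y) = ac k x + ac k y.
Proof. by rewrite ac_st subrr st0. Qed.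

(** Writing c = 3k, [ac k] carries [st c] to addition; associativity below follows in the same
    way. *)
Lemma stC c x y : st c x y = st c y x.
Proof.
by have [k <-] := C3 c; apply: (can_inj (acK k)); rewrite !ac_st3 addrC.
Qed.

Lemma stA c x y z : st c (st c x y) z = st c x (st c y z).
Proof.
by have [k <-] := C3 c; apply: (can_inj (acK k)); rewrite !ac_st3 addrA.
Qed.

(** [locked] keeps it an atom for [zmod] and for rewriting. *)
Definition twist c x y := locked (st c x y - x - y).

Lemma twistE c x y : twist c x y = st c x y - x - y.
Proof. by rewrite /twist -lock. Qed.

Lemma stE c x y : st c x y = x + y + twist c x y.
Proof. by rewrite twistE; zmod. Qed.

Lemma twistC c x y : twist c x y = twist c y x.
Proof. by rewrite !twistE stC; zmod. Qed.

Lemma twistxx c x : twist c x x = 0.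
Proof. by rewrite twistE stxx; zmod. Qed.

Lemma twistDr c x y z : twist c x (y + z) = twist c x y + twist c x z.
Proof.
have [k Ek] := C3 c; rewrite -(acNK k x) -(acNK k y) -(acNK k z).
move: (ac (- k) x) (ac (- k) y) (ac (- k) z) => {x y z} w y z.
(* The case y = 0 of [st_shift]. *)
have st2 u : st c w (st c (ac c w) (u - ac c w)) = st (c + c) w u.
  by have := st_shift c w 0 u; rewrite stx0 st0x stA.
(* [ac k] sends [st c] to addition and [st (c + c)] to [st c], so E becomes w + st c w (y + z) = st
   c w y + st c w z, which is additivity of the twist. *)
have E : st c w (st (c + c) w (st c y z)) = st c (st (c + c) w y) (st (c + c) w z).
  by rewrite -st_shift -(st2 z) -!stA (stC c w).
have ac_st6 u v : ac k (st (c + c) u v) = st c (ac k u) (ac k v).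
  by rewrite ac_st Ek addrK.
have ac_stc u v : ac k (st c u v) = ac k u + ac k v by rewrite -Ek ac_st3.
move: E => /(congr1 (ac k)); rewrite !(ac_stc, ac_st6) !stE => E.
apply: (addrI (ac k w + (ac k w + (ac k y + ac k z)))).
by rewrite -addrA {}E; zmod.
Qed.

Lemma twistDl c x y z : twist c (x + y) z = twist c x z + twist c y z.
Proof. by rewrite twistC twistDr !(twistC c z). Qed.

Lemma twist0 c x : twist c x 0 = 0.
Proof. by rewrite twistE stx0; zmod. Qed.

Lemma twist2 c x y : twist c x y + twist c x y = 0.
Proof.
by have := twistxx c (x + y); rewrite twistDl !twistDr !twistxx add0r addr0 (twistC c y).
Qed.

Lemma twistN c x y : twist c x (- y) = twist c x y.
Proof.
apply: (addIr (twist c x y)); rewrite twist2 -twistDr addNr; exact: twist0.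
Qed.

Lemma twist_ac c w : twist c w (ac c w) = 0.
Proof.
by have := st_double c w 0; rewrite !stx0 twistE addrAC => ->; rewrite subrr.
Qed.

(** After biadditive expansion, associativity of [st c] leaves only the two nested twists. *)
Lemma twistA c x y z : twist c (twist c x y) z = twist c x (twist c y z).
Proof.
have := stA c x y z; rewrite !stE !twistDl !twistDr => E.
apply: (addrI (x + y + z + twist c x y + twist c y z + twist c x z)).
by transitivity (x + y + twist c x y + z +
  (twist c x z + twist c y z + twist c (twist c x y) z)); [zmod|rewrite E; zmod].
Qed.

Lemma twist_twist_ac c w y : twist c (twist c w y) (ac c w) = 0.
Proof. by rewrite (twistC c w) twistA twist_ac twist0. Qed.

Lemma st_double_twist c w y z :
  st (c + c) w (st c y z) =
  w + y + z + twist c w y + twist c w z + twist c y z + twist c (twist c w y) z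
  + twist c (ac c w) y + twist c (ac c w) z.
Proof.
rewrite -st_shift.
have -> : st c (st (c + c) w y) (ac c w) = st c w y + ac c w.
  by rewrite -(st_double c w y); zmod.
rewrite !stE !twistDl !twistDr !twistN !twistxx twist_ac twist_twist_ac.
by rewrite (twistC c y (ac c w)); zmod.
Qed.

Lemma st_doubleE c w y : st (c + c) w y = st c w y + twist c (ac c w) y.
Proof.
by have := st_double_twist c w y 0; rewrite stx0 !twist0 => ->; rewrite stE; zmod.
Qed.

(** Expand st (c + c) w (st c x y) by [st_double_twist] and by [st_doubleE]: the results differ by a
    single nested twist with [ac c w], and [ac c] is onto. *)
Lemma twist_twist c x y z : twist c (twist c x y) z = 0.
Proof.
rewrite twistC; rewrite -(acNK c z); move: (ac (- c) z) => {z} w.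
have := st_double_twist c w x y; rewrite st_doubleE !stE !twistDr -twistA => E.
apply: (addrI (w + x + y + twist c w x + twist c w y + twist c x y +
  twist c (twist c w x) y + twist c (ac c w) x + twist c (ac c w) y)).
by rewrite addr0 -[RHS]E; zmod.
Qed.

Lemma beta_twist k x y : beta (ac k) (ac (- k)) x y = twist (k *+ 3) x y.
Proof. by rewrite twistE /beta -ac_st3 acK. Qed.

Lemma f3_ac k x : f3 (ac k) x = ac (k *+ 3) x.
Proof. by rewrite /f3 -!acD !mulrSr mulr0n add0r. Qed.

Lemma ac_moufang_perm k : moufang_perm (ac k) (ac (- k)).
Proof.
split; first exact: acK.
split; first exact: acNK.
split; first by move=> x y; rewrite !beta_twist twistC.
split; first by move=> x; rewrite beta_twist twistxx.
split; first by move=> x y z; rewrite !beta_twist twistDl.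
split; first by move=> x y z; rewrite !beta_twist twistDr.
split; first by move=> x y z; rewrite !beta_twist twist_twist.
move=> x y; rewrite f3_ac !beta_twist.
set c := k *+ 3.
(* Applying [ac k] to [st (c + c) x y] gives [st c (ac k x) (ac k y)]. The correction term from
   [st_doubleE] has trivial twist with everything, so [ac k] splits additively and the identity for
   β(f x, f y) remains. *)
have := ac_st (c + c) k x y; rewrite addrK st_doubleE.
set r := twist c (ac c x) y; have -> : st c x y + r = st c (st c x y) r.
  by rewrite (stE c (st c x y)) (twistC c _ r) twist_twist addr0.
rewrite !ac_st3 stE => E; apply: (addrI (ac k x + ac k y)); exact: esym.
Qed.

End TwistedAdditions.

(** * Inverse property and Bol identities of Moufang loops *)

(** If zx = e, the Moufang identity and flexibility give xy = x((yz)x); cancel x. The left law comes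
    similarly from xy = e. *)
Lemma moufang_inverse (Q : Type) (mul : Q -> Q -> Q) (e : Q) :
  is_loop mul -> moufang mul -> (forall x, mul e x = x /\ mul x e = x) ->
  exists inv : Q -> Q, forall x y,
    [/\ mul x (mul (inv x) y) = y, mul (inv x) (mul x y) = y,
        mul (mul y x) (inv x) = y & mul (mul y (inv x)) x = y].
Proof.
move=> [_ [ldiv rdiv]] M eP.
have linj a x y : mul a x = mul a y -> x = y.
  by move=> E; have [w [_ U]] := ldiv a (mul a y); rewrite -(U x) // -(U y).
have rinj a x y : mul x a = mul y a -> x = y.
  by move=> E; have [w [_ U]] := rdiv a (mul y a); rewrite -(U x) // -(U y).
have flex x y : mul x (mul y x) = mul (mul x y) x.
  by have := M x e y; rewrite (eP x).2 (eP y).1.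
have RIP x z y : mul z x = e -> mul (mul y z) x = y.
  move=> E; have := M x y z; rewrite E (eP _).2 -flex => H.
  by apply: (linj x).
have LIP x y z : mul x y = e -> mul x (mul y z) = z.
  move=> E; have := M x y z; rewrite E (eP _).1 => H.
  by apply: (rinj x).
have ex_inv x : exists y, mul y x = e by have [y [E _]] := rdiv x e; exists y.
have inv_r x y : mul y x = e -> mul x y = e.
  by move=> E; apply: (rinj x); rewrite (RIP _ _ _ E) (eP x).1.
pose inv x := proj1_sig (constructive_indefinite_description _ (ex_inv x)).
have invl x : mul (inv x) x = e.
  by rewrite /inv; case: constructive_indefinite_description.
exists inv => x y; have invr := inv_r _ _ (invl x).
by split; [apply: LIP|apply: LIP|apply: RIP|apply: RIP].
Qed.

Section MoufangIdentities.
Variables (Q : Type) (mul : Q -> Q -> Q) (e : Q) (inv : Q -> Q).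
Hypotheses (M : moufang mul) (eP : forall x, mul e x = x /\ mul x e = x)
  (invP : forall x y,
    [/\ mul x (mul (inv x) y) = y, mul (inv x) (mul x y) = y,
        mul (mul y x) (inv x) = y & mul (mul y (inv x)) x = y]).

Local Notation "x ** y" := (mul x y) (at level 40, left associativity).

Let mul1l x : e ** x = x. Proof. by case: (eP x). Qed.
Let mul1r x : x ** e = x. Proof. by case: (eP x). Qed.

Lemma mulKinv x y : inv x ** (x ** y) = y. Proof. by case: (invP x y). Qed.
Lemma mulVK x y : x ** (inv x ** y) = y. Proof. by case: (invP x y). Qed.
Lemma mulrKinv x y : y ** x ** inv x = y. Proof. by case: (invP x y). Qed.
Lemma mulrVK x y : y ** inv x ** x = y. Proof. by case: (invP x y). Qed.

Lemma mulVl x : inv x ** x = e. Proof. by rewrite -{2}(mul1r x) mulKinv. Qed.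

Lemma inv_unique x y : x ** y = e -> inv x = y.
Proof. by move=> E; rewrite -(mulKinv x y) E mul1r. Qed.

Lemma invK x : inv (inv x) = x.
Proof. exact/inv_unique/mulVl. Qed.

Lemma moufang_flexible x y : x ** (y ** x) = x ** y ** x.
Proof. by have := M x e y; rewrite mul1l mul1r. Qed.

Lemma invM x y : inv (x ** y) = inv y ** inv x.
Proof.
have <- : y ** inv (x ** y) = inv x by rewrite -{1}(mulKinv x y) mulrKinv.
by rewrite mulKinv.
Qed.

(** Multiply x(uv)·(v^-1 x) = xux on the right by (v^-1 x)^-1 = x^-1 v. *)
Lemma moufang_left x u v : x ** u ** x ** (inv x ** v) = x ** (u ** v).
Proof.
by rewrite -{2}(invK v) -(mulrKinv (inv v ** x) (x ** (u ** _))) M mulrVK invM invK.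
Qed.

Lemma moufang_right x u v : u ** inv x ** (x ** v ** x) = u ** v ** x.
Proof.
by rewrite -{2}(invK u) -(mulKinv (x ** inv u) (inv (inv u) ** v ** x)) M mulVK invM invK.
Qed.

Lemma bol_left x w z : x ** (w ** (x ** z)) = x ** w ** x ** z.
Proof. by rewrite -moufang_left mulKinv. Qed.

Lemma bol_right x w z : z ** x ** w ** x = z ** (x ** w ** x).
Proof. by rewrite -moufang_right mulrKinv. Qed.

End MoufangIdentities.

(** Strong induction through L_b L_(b^j) L_b = L_(b^(j+2)). The multiplication is arbitrary so that
    the opposite loop is covered too. *)
Lemma bol_power (Q : Type) (mul : Q -> Q -> Q) (C : zmodType) (kappa : C -> Q) (b : C) :
  (forall x w z, mul x (mul w (mul x z)) = mul (mul (mul x w) x) z) ->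
  (forall z, mul (kappa 0) z = z) ->
  (forall c d, kappa (c + d) = mul (kappa c) (kappa d)) ->
  forall n z, mul (kappa (b *+ n)) z = iter n (mul (kappa b)) z.
Proof.
move=> bol k0 kD n z.
suff H m : forall z, mul (kappa (b *+ m.+1)) z = mul (kappa b) (mul (kappa (b *+ m)) z).
  by elim: n => [|n IH]; rewrite ?mulr0n ?k0 // H IH.
have bol2 j w : mul (kappa b) (mul (kappa (b *+ j)) (mul (kappa b) w)) =
    mul (kappa (b *+ j.+2)) w.
  by rewrite bol -!kD -mulrS -mulrSr.
elim/ltn_ind: m => -[|[|m]] IH {}z.
- by rewrite k0.
- by rewrite -bol2 mulr0n k0.
- by rewrite -bol2 IH // bol2.
Qed.

Lemma iter_commute (T : Type) (f g : T -> T) m n x :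
  (forall y, f (g y) = g (f y)) -> iter m f (iter n g x) = iter n g (iter m f x).
Proof.
move=> fg; elim: m => [//|m IH]; rewrite iterS IH.
by elim: n {IH} => [//|n IH]; rewrite iterS fg IH.
Qed.

(** * Conjugation and twisted additions in a Moufang loop Q = CX *)

Section CyclicExtension.
Variables (X C : zmodType) (b : C) (Q : Type) (mul : Q -> Q -> Q) (e : Q) (inv : Q -> Q).
Hypotheses (hb : forall c : C, exists n : nat, c = b *+ n)
  (M : moufang mul) (eP : forall x, mul e x = x /\ mul x e = x)
  (invP : forall x y,
    [/\ mul x (mul (inv x) y) = y, mul (inv x) (mul x y) = y,
        mul (mul y x) (inv x) = y & mul (mul y (inv x)) x = y]).

Local Notation "x ** y" := (mul x y) (at level 40, left associativity).

Variables (iota : X -> Q) (kappa : C -> Q).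
Hypotheses (iota_inj : injective iota)
  (iotaD : forall x y, iota (x + y) = iota x ** iota y)
  (iotaN : normal_subloop mul (fun q => exists x, q = iota x))
  (kappaD : forall c d, kappa (c + d) = kappa c ** kappa d)
  (kappa_iota : forall c x, kappa c = iota x -> c = 0 /\ x = 0).

Let mul1l x : e ** x = x. Proof. by case: (eP x). Qed.
Let mul1r x : x ** e = x. Proof. by case: (eP x). Qed.

Lemma hom_zero (A : zmodType) (h : A -> Q) :
  (forall x y, h (x + y) = h x ** h y) -> h 0 = e.
Proof. by move=> hD; rewrite -(mulKinv invP (h 0) (h 0)) -hD addr0 (mulVl eP invP). Qed.

Let iota0 : iota 0 = e. Proof. exact: (hom_zero iotaD). Qed.
Let kappa0 : kappa 0 = e. Proof. exact: (hom_zero kappaD). Qed.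

Let iota_opp x : inv (iota x) = iota (- x).
Proof. by apply: (inv_unique eP invP); rewrite -iotaD subrr. Qed.
Let kappa_opp c : inv (kappa c) = kappa (- c).
Proof. by apply: (inv_unique eP invP); rewrite -kappaD subrr. Qed.

Let kl n z : kappa (b *+ n) ** z = iter n (mul (kappa b)) z.
Proof.
by apply: (@bol_power _ mul _ kappa) => // [|w]; [apply: (bol_left M eP invP)|rewrite kappa0].
Qed.

Let kr n z : z ** kappa (b *+ n) = iter n (fun w => w ** kappa b) z.
Proof.
apply: (@bol_power _ (fun x y => y ** x) _ kappa) => [x w u|w|c d].
- by rewrite (bol_right M eP invP) (moufang_flexible M eP).
- by rewrite kappa0.
- by rewrite addrC kappaD.
Qed.

Lemma kappa_mulA c d z : kappa (c + d) ** z = kappa c ** (kappa d ** z).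
Proof. by have [m ->] := hb c; have [n ->] := hb d; rewrite -mulrnDr !kl iterD. Qed.

Lemma kappa_mulrA c d z : z ** kappa (c + d) = z ** kappa c ** kappa d.
Proof.
by have [m ->] := hb c; have [n ->] := hb d; rewrite addrC -mulrnDr !kr iterD.
Qed.

(** Both translations are iterates of those by [kappa b], which commute by flexibility. *)
Lemma kappa_mulCA c d z : kappa c ** (z ** kappa d) = kappa c ** z ** kappa d.
Proof.
have [m ->] := hb c; have [n ->] := hb d; rewrite !kl !kr iter_commute // => y.
exact: (moufang_flexible M eP).
Qed.

Lemma conj_exists c x : exists y, kappa c ** iota x = iota y ** kappa c.
Proof.
have [_ /(_ (kappa c) (kappa c)) [H _]] := iotaN.
by have [|_ [y ->] ->] := (H (kappa c ** iota x)).1; [exists (iota x) => //; exists x|exists y].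
Qed.

Lemma star_exists c x y : exists z, kappa c ** iota x ** iota y = kappa c ** iota z.
Proof.
have [_ /(_ (iota x) (kappa c)) [_ [_ H]]] := iotaN.
have [|_ [z ->] ->] := (H (kappa c ** iota x ** iota y)).2.
  by exists (iota y) => //; exists y.
by exists (x + z); rewrite iotaD.
Qed.

(** [conj_act] and [star] realise [ac] and [st] of the previous section; normality of X supplies the
    values, cancellation their uniqueness. *)
Definition conj_act c x := proj1_sig (constructive_indefinite_description _ (conj_exists c x)).
Definition star c x y := proj1_sig (constructive_indefinite_description _ (star_exists c x y)).

Local Notation ac := conj_act.

Lemma conj_actP c x : kappa c ** iota x = iota (ac c x) ** kappa c.
Proof. by rewrite /ac; case: constructive_indefinite_description. Qed.

Lemma starP c x y : kappa c ** iota x ** iota y = kappa c ** iota (star c x y).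
Proof. by rewrite /star; case: constructive_indefinite_description. Qed.

Lemma mul_inj a x y : a ** x = a ** y -> x = y.
Proof. by move=> E; rewrite -(mulKinv invP a x) E (mulKinv invP). Qed.

Lemma mul_injr a x y : x ** a = y ** a -> x = y.
Proof. by move=> E; rewrite -(mulrKinv invP a x) E (mulrKinv invP). Qed.

Lemma decomp_inj c d x y : kappa c ** iota x = kappa d ** iota y -> c = d /\ x = y.
Proof.
move=> E; have /kappa_iota [Ecd _] : kappa (- d + c) = iota (y - x).
  apply: (@mul_injr (iota x)); rewrite kappa_mulA E -kappa_mulA addNr kappa0 mul1l.
  by rewrite -iotaD subrK.
have {}Ecd : c = d by apply/eqP; rewrite -subr_eq0 addrC Ecd.
by split=> //; apply/iota_inj; move: E; rewrite Ecd => /mul_inj.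
Qed.

Lemma star_inj c x y : kappa c ** iota x = kappa c ** iota y -> x = y.
Proof. by case/decomp_inj. Qed.

Lemma conj_act0 x : ac 0 x = x.
Proof. by have := conj_actP 0 x; rewrite kappa0 mul1l mul1r => /iota_inj. Qed.

Lemma conj_actD c d x : ac (c + d) x = ac c (ac d x).
Proof.
apply/iota_inj/(@mul_injr (kappa (c + d))).
by rewrite -conj_actP kappa_mulA conj_actP kappa_mulCA conj_actP kappa_mulrA.
Qed.

Let acKN c x : ac c (ac (- c) x) = x. Proof. by rewrite -conj_actD subrr conj_act0. Qed.

Lemma mul_kappa c d x : kappa c ** iota x ** kappa d = kappa (c + d) ** iota (ac (- d) x).
Proof. by rewrite kappa_mulA (conj_actP d) acKN kappa_mulCA. Qed.

Lemma iota_kappa d x : iota x ** kappa d = kappa d ** iota (ac (- d) x).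
Proof. by rewrite conj_actP acKN. Qed.

(** [moufang_left] gives (d·cx·d) y = d (cx·dy); cancel d. *)
Lemma mul_decomp c d x y :
  kappa c ** iota x ** (kappa d ** iota y) =
  kappa (c + d) ** iota (star (c + d + d) (ac (- d) x) y).
Proof.
have := moufang_left M eP invP (kappa d) (kappa c ** iota x) (kappa d ** iota y).
rewrite (mulKinv invP) -kappa_mulA mul_kappa starP => E.
apply: (@mul_inj (kappa d)); rewrite -E -kappa_mulA addrA.
by have -> : c + d + d = d + c + d by zmod.
Qed.

Lemma star0 x y : star 0 x y = x + y.
Proof.
by apply: (@star_inj 0); rewrite -starP kappa0 !mul1l iotaD.
Qed.

Lemma starx0 c x : star c x 0 = x.
Proof. by apply: (@star_inj c); rewrite -starP iota0 mul1r. Qed.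

Lemma star0x c x : star c 0 x = x.
Proof. by apply: (@star_inj c); rewrite -starP iota0 mul1r. Qed.

Lemma starxx c x : star c x x = x + x.
Proof.
apply: (@star_inj c); rewrite -starP iotaD.
by have := bol_right M eP invP (iota x) e (kappa c); rewrite !mul1r.
Qed.

(** [moufang_right] for k^-1: (cx·k)(k^-1 y k^-1) = (cx·y) k^-1, with both sides brought to the form
    C times X. *)
Lemma conj_act_star c k x y : ac k (star c x y) = star (c - k *+ 3) (ac k x) (ac k y).
Proof.
have := moufang_right M eP invP (kappa (- k)) (kappa c ** iota x) (iota y).
rewrite kappa_opp starP !mul_kappa opprK mul_decomp -conj_actD => E.
apply: (@star_inj (c - k)); rewrite -E.
have -> : c + k + (- k - k) = c - k by zmod.
have -> : c - k + (- k - k) = c - k *+ 3 by rewrite !mulrSr mulr0n add0r; zmod.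
by have -> : - (- k - k) - k = k by zmod.
Qed.

Let iota_mul x c y :
  iota x ** (kappa c ** iota y) = kappa c ** iota (star (c + c) (ac (- c) x) y).
Proof. by have := mul_decomp 0 c x y; rewrite kappa0 mul1l !add0r. Qed.

(** [moufang_left] for an element of X, with u = c y and v = z in X; the next lemma takes v = c
    instead. *)
Lemma star_shift c w y z :
  star c (star c (star (c + c) w y) (ac c w)) (z - ac c w) = star (c + c) w (star c y z).
Proof.
apply: (@star_inj c).
have := moufang_left M eP invP (iota (ac c w)) (kappa c ** iota y) (iota z).
rewrite iota_opp -iotaD !(starP, iota_mul) -!conj_actD addNr conj_act0.
by rewrite (addrC _ z).
Qed.

Lemma star_double c w y :
  star c (star (c + c) w y) (ac c w) - ac c w = star c w y.
Proof.
have := moufang_left M eP invP (iota (ac c w)) (kappa c ** iota y) (kappa c).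
rewrite iota_opp iota_kappa iota_mul starP -conj_actD addNr conj_act0.
set s := star c _ _; move: s => s; rewrite mul_kappa iota_mul mul_decomp.
(* [ac c] lowers the subscript of [star] by 3c: from 3c to 0, where [star] is addition, and from 4c
   to c. *)
case/decomp_inj => _ /(congr1 (ac c)); rewrite !conj_act_star !acKN -!conj_actD.
have -> : c + c + c - c *+ 3 = 0 by rewrite !mulrSr mulr0n add0r subrr.
rewrite star0 => ->.
have -> : c + c + (c + c) - c *+ 3 = c by rewrite !mulrSr mulr0n add0r; zmod.
have -> : c - (c + c) + c = 0 by zmod.
by rewrite conj_act0.
Qed.

End CyclicExtension.

(** * Orders, and the isomorphism with a semidirect product *)

(** Subtracting copies of the least r from n shows that the remainder satisfies [P], so minimality
    makes it zero. *)
Lemma least_divides_of_sub (P : nat -> Prop) n :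
  (0 < n)%N -> P n -> (forall m k, P m -> P (k + m)%N -> P k) -> least_divides P n.
Proof.
move=> n0 Pn Psub.
have [r [r0 Pr rmin]] : exists r, [/\ (0 < r)%N, P r & forall m, (0 < m)%N -> P m -> (r <= m)%N].
  elim/ltn_ind: n n0 Pn => n IH n0 Pn.
  have [[m [mn m0 Pm]]|H] := classic (exists m, [/\ (m < n)%N, (0 < m)%N & P m]).
    exact: IH mn m0 Pm.
  exists n; split=> // m m0 Pm; rewrite leqNgt; apply/negP => mn; apply: H.
  by exists m.
exists r; split.
  split=> //; split=> // m m0 mr Pm; have := rmin m m0 Pm.
  by rewrite leqNgt mr.
rewrite /dvdn eqn0Ngt; apply/negP => nr0.
have Pmod : P (n %% r)%N.
  move: Pn; rewrite {1}(divn_eq n r) addnC; elim: (n %/ r)%N => [|q IH].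
    by rewrite mul0n addn0.
  by rewrite mulSn addnCA addnC => /(Psub _ _ Pr).
by have := rmin _ nr0 Pmod; rewrite leqNgt ltn_pmod.
Qed.

Lemma cyclic_nat_multiple (C : zmodType) (b : C) :
  (forall c : C, exists i : int, c = b *~ i) -> three_divisible C ->
  forall c : C, exists n : nat, c = b *+ n.
Proof.
move=> hb C3 c; have [i ->] := hb c; case: i => m; first by exists m.
have [k Ek] := C3 b; have [j Ej] := hb k.
(* [b] has finite order: it is killed by [3 j - 1]. *)
have b0 : b *~ (j * 3 - 1) = 0.
  by rewrite mulrzBr mulrzA -Ej mulr1z -pmulrn Ek subrr.
have {}b0 : b *+ absz (j * 3 - 1)%R = 0.
  case: (intP (j * 3 - 1)) b0 => [|n|n]; rewrite ?abszN ?absz_nat //.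
  by rewrite mulrNz => /eqP; rewrite oppr_eq0 => /eqP.
have n0 : (0 < absz (j * 3 - 1)%R)%N by lia.
(* Here c = -(m+1) b; adding n (m+1) b = 0 makes the coefficient non-negative, as n > 0. *)
move: (absz _) n0 b0 => n n0 b0; exists (n * m.+1 - m.+1)%N.
rewrite NegzE mulrNz -pmulrn mulrnBr; last by rewrite leq_pmull.
by rewrite mulrnA b0 mul0rn sub0r.
Qed.

Lemma moufang_cyclic_extension_is_semidirect (X C : zmodType) (b : C)
    (hb : forall c : C, exists i : int, c = b *~ i) (hC : three_divisible C)
    (Q : Type) (mul : Q -> Q -> Q) (hQ : is_loop mul) (iota : X -> Q) (kappa : C -> Q) :
  moufang mul ->
  injective iota -> (forall x y, iota (x + y) = mul (iota x) (iota y)) ->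
  normal_subloop mul (fun q => exists x, q = iota x) ->
  (forall c d, kappa (c + d) = mul (kappa c) (kappa d)) ->
  (forall q, exists c x, q = mul (kappa c) (iota x)) ->
  (forall c x, kappa c = iota x -> c = 0 /\ x = 0) ->
  exists f finv : X -> X,
    moufang_perm f finv /\
    sd_defined b (f3 f) (beta f finv) /\
    iso_to_sd mul b (f3 f) (f3 finv) (beta f finv).
Proof.
move=> hM iota_inj iotaD iotaN kappaD decomp kappa_iota.
have [[e eP] _] := hQ; have [inv invP] := moufang_inverse hQ hM eP.
have hbN := cyclic_nat_multiple hb hC.
pose ac := conj_act kappa iotaN; pose st := star kappa iotaD iotaN.
have ac0 : forall x, ac 0 x = x := conj_act0 eP invP iota_inj iotaN kappaD.
have acD : forall c d x, ac (c + d) x = ac c (ac d x) :=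
  conj_actD hbN hM eP invP iota_inj iotaN kappaD.
have st0 : forall x y, st 0 x y = x + y :=
  star0 hbN hM eP invP iota_inj iotaD iotaN kappaD kappa_iota.
have ac_st : forall c k x y, ac k (st c x y) = st (c - k *+ 3) (ac k x) (ac k y) :=
  conj_act_star hbN hM eP invP iota_inj iotaD iotaN kappaD kappa_iota.
(* The permutation is conjugation by a cube root of b, so its cube is conjugation by b. *)
have [k Ek] := hC b.
have Hf : moufang_perm (ac k) (ac (- k)).
  apply: (@ac_moufang_perm X C ac st) => //.
  - exact: (starx0 hbN hM eP invP iota_inj iotaD iotaN kappaD kappa_iota).
  - exact: (star0x hbN hM eP invP iota_inj iotaD iotaN kappaD kappa_iota).
  - exact: (starxx hbN hM eP invP iota_inj iotaD iotaN kappaD kappa_iota).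
  - exact: (star_shift hbN hM eP invP iota_inj iotaD iotaN kappaD kappa_iota).
  - exact: (star_double hbN hM eP invP iota_inj iotaD iotaN kappaD kappa_iota).
have acK c : cancel (ac c) (ac (- c)) := acK ac0 acD c.
have acNK c : cancel (ac (- c)) (ac c) := acNK ac0 acD c.
have zpow_ac m x : zpow (ac k) (ac (- k)) m x = ac (k *~ m) x.
  elim/int_step_ind: m => [|m IH|m]; first by rewrite mulr0z ac0.
    by rewrite (zpowS (acNK k)) IH -acD addrC mulrzDr mulr1z.
  by rewrite (zpowS (acNK k)) addrC mulrzDr mulr1z acD => /(can_inj (acK k)).
(* Since b m = 3 (k m), [star] at b m is addition conjugated by the m-th power of f. *)
have star_zpow m x y : zpow (ac k) (ac (- k)) (- m)
    (zpow (ac k) (ac (- k)) m x + zpow (ac k) (ac (- k)) m y) = st (b *~ m) x y.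
  have -> : b *~ m = k *~ m *+ 3 by rewrite -Ek !pmulrn -!mulrzA mulrC.
  by rewrite !zpow_ac mulrNz -(ac_st3 st0 ac_st) acK.
have iter_f3 m x : iter m (f3 (ac k)) x = zpow (ac k) (ac (- k)) (m%:Z * 3) x.
  by rewrite -(zpow_f3 (acK k) (acNK k)).
exists (ac k), (ac (- k)); split=> //; split.
- move=> n [n0 [bn0 _]]; split; apply: least_divides_of_sub => //.
  + by move=> x; rewrite iter_f3 zpow_ac mulrC mulrzA -[k *~ 3]/(k *+ 3) Ek -pmulrn bn0 ac0.
  + by move=> m l Hm Hl x; have := Hl x; rewrite iterD Hm.
  (* At n b = 0 [star] is addition, so the sum in [zpow_conj_add] with j = 0 vanishes; term by term
     it is β(Σ f^(3t) x, y). *)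
  + move=> x y; have := zpow_conj_add Hf n 0 x y.
    rewrite star_zpow -pmulrn bn0 st0 zpow0 addr0 -[LHS]addr0 => /addrI.
    rewrite /sumI subr0 absz_nat => E; rewrite [RHS]E.
    have -> : Num.min n%:Z 0 = 0 by lia.
    rewrite (big_morph (fun u => beta (ac k) (ac (- k)) u y) (op1 := +%R) (id1 := 0));
      [|by move=> u v; rewrite (betaDl Hf)|exact: (beta0l Hf)].
    apply: eq_bigr => t _; rewrite add0r -(beta_zpowl Hf).
    by rewrite iter_f3 mulrC.
  + move=> m l Hm Hl x y; have := Hl x y.
    (* The tail of the sum is the length-m sum started at f^(3l) x, hence radical. *)
    rewrite (@big_cat_nat _ _ _ l) //=; last exact: leq_addr.
    rewrite (betaDl Hf) -{2}[l]add0n big_addn addnC addnK.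
    by under [X in _ + beta _ _ X _]eq_bigr do rewrite iterD; rewrite Hm addr0.
have inj c d x y : mul (kappa c) (iota x) = mul (kappa d) (iota y) -> c = d /\ x = y :=
  @decomp_inj _ _ _ _ _ _ _ hbN hM eP invP _ _ iota_inj iotaD kappaD kappa_iota c d x y.
have ex q : exists p : C * X, q = mul (kappa p.1) (iota p.2).
  by have [c [x ->]] := decomp q; exists (c, x).
pose phi q := proj1_sig (constructive_indefinite_description _ (ex q)).
have phiP q : q = mul (kappa (phi q).1) (iota (phi q).2).
  by rewrite /phi; case: constructive_indefinite_description.
have phiE c x : phi (mul (kappa c) (iota x)) = (c, x).
  have [E1 E2] := inj _ _ _ _ (phiP (mul (kappa c) (iota x))).
  by rewrite [LHS]surjective_pairing -E1 -E2.
exists phi; split.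
  exists (fun p => mul (kappa p.1) (iota p.2)) => [q|[c x]]; first by rewrite -phiP.
  exact: phiE.
move=> q q' i j.
have -> : mul q q' = mul (mul (kappa (phi q).1) (iota (phi q).2))
    (mul (kappa (phi q').1) (iota (phi q').2)) by rewrite -!phiP.
move: (phi q) (phi q') => [c x] [d y] /= <- <-.
rewrite (mul_decomp hbN hM eP invP iota_inj iotaD iotaN kappaD) phiE -/ac -/st.
rewrite mulrzDr (sd_compE Hf); congr (_, _).
have -> : b *~ i + b *~ j + b *~ j = b *~ (i + 2 * j).
  by rewrite -!mulrzDr; congr (_ *~ _); lia.
(* Conjugation by b^-j is f^(-3j), which turns the exponent i + 2j into i - j. *)
rewrite -star_zpow; congr (zpow _ _ _ (_ + _)).
rewrite !zpow_ac -acD -Ek -[k *+ 3]/(k *~ 3) -mulrzA -mulrNz -mulrzDr.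
by congr (ac (_ *~ _) _); lia.
Qed.

Theorem mainTheorem18 (X C : zmodType) (b : C)
  (hb : forall c : C, exists i : int, c = b *~ i)
  (hX : three_divisible X) (hC : three_divisible C)
  (Q : Type) (mul : Q -> Q -> Q) (hQ : is_loop mul) :
  (moufang mul /\
   exists (iota : X -> Q) (kappa : C -> Q),
     injective iota /\ (forall x y, iota (x + y) = mul (iota x) (iota y)) /\
     normal_subloop mul (fun q => exists x, q = iota x) /\
     injective kappa /\ (forall c d, kappa (c + d) = mul (kappa c) (kappa d)) /\
     subloop mul (fun q => exists c, q = kappa c) /\
     (forall q, exists c x, q = mul (kappa c) (iota x)) /\
     (forall c x, kappa c = iota x -> c = 0 /\ x = 0))
  <->
  (exists f finv : X -> X,
     moufang_perm f finv /\
     sd_defined b (f3 f) (beta f finv) /\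
     iso_to_sd mul b (f3 f) (f3 finv) (beta f finv)).
Proof.
split=> [[M [iota [kappa [H1 [H2 [H3 [_ [H4 [_ [H5 H6]]]]]]]]]]|[f [finv [Hf [_ H]]]]].
  exact: (moufang_cyclic_extension_is_semidirect hb hC hQ M H1 H2 H3 H4 H5 H6).
exact (semidirect_is_moufang hb hQ Hf H).
Qed.
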